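(* Let $G$ be an open subset of $\mathbb{R}^n$, $Y$ a Banach space, and $f:G \to Y$ a mapping which is Gâteaux differentiable at every point of $G$. Then $f$ is Fréchet differentiable at all points of $G$ except a nowhere dense $\sigma$-porous set.
   Context: Banach spaces are real. $B(x,r)$ is the open ball with center $x$ and radius $r$. $f:G\to Y$ is Gâteaux differentiable at $x\in G$ if there is a (continuous) linear operator $L:\mathbb{R}^n\to Y$ with $\lim_{t\to 0}\frac{f(x+tv)-f(x)}{t}=L(v)$ for each $v\in \mathbb{R}^n$. A set $A\subset \mathbb{R}^n$ is (upper) porous at $x$ if there exist $p>0$ and a sequence of points $y_k\to x$, $y_k\neq x$, such that $B(y_k,p\|y_k-x\|)\cap A=\emptyset$ for each $k$. $A$ is porous if it is porous at each of its points, and $\sigma$-porous if it is a countable union of porous sets. *)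

(* Defs.v *)
From HB Require Import structures.
From mathcomp Require Import all_boot all_order all_algebra.
From mathcomp Require Import all_classical all_reals all_analysis.

Set Implicit Arguments.
Unset Strict Implicit.
Unset Printing Implicit Defensive.

Import Order.TTheory GRing.Theory Num.Theory.
Import numFieldNormedType.Exports.

Local Open Scope classical_set_scope.
Local Open Scope ring_scope.

(* The library norm `|x| on 'rV[R]_n is the sup norm; balls in R^n are taken
   for the Euclidean norm instead.  The two norms are equivalent, so openness,
   closure, limits and [differentiable] are the Euclidean ones. *)
Definition enorm (R : realType) (n : nat) (x : 'rV[R]_n) : R :=
  Num.sqrt (\sum_(i < n) x ord0 i ^+ 2).

Definition eball (R : realType) (n : nat) (x : 'rV[R]_n) (r : R) :
    set 'rV[R]_n :=
  [set y | enorm (y - x) < r].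

(* [f] is total, but only its values near [x] matter: for [x] in an open [G]
   the notion depends only on the restriction of [f] to [G]. *)
Definition gateaux_differentiable (R : realType) (V Y : normedModType R)
    (f : V -> Y) (x : V) : Prop :=
  exists L : {linear V -> Y}, continuous L /\
    forall v : V, t^-1 *: (f (x + t *: v) - f x) @[t --> (0 : R)^'] --> L v.

Definition porous_at (R : realType) (n : nat) (A : set 'rV[R]_n)
    (x : 'rV[R]_n) : Prop :=
  exists p : R, 0 < p /\
  exists y : nat -> 'rV[R]_n,
    [/\ y k @[k --> \oo] --> x,
        forall k, y k != x &
        forall k, eball (y k) (p * enorm (y k - x)) `&` A = set0].

Definition porous (R : realType) (n : nat) (A : set 'rV[R]_n) : Prop :=
  forall x, A x -> porous_at A x.

Definition sigma_porous (R : realType) (n : nat) (A : set 'rV[R]_n) : Prop :=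
  exists P : nat -> set 'rV[R]_n,
    (forall k, porous (P k)) /\ A = \bigcup_k P k.

Definition nowhere_dense (T : topologicalType) (A : set T) : Prop :=
  interior (closure A) = set0.

(* Main.v *)
Require Import Defs.
From HB Require Import structures.
From mathcomp Require Import all_boot all_order all_algebra.
From mathcomp Require Import all_classical all_reals all_analysis.
From mathcomp Require Import ring lra.

Set Implicit Arguments.
Unset Strict Implicit.
Unset Printing Implicit Defensive.

Import Order.TTheory GRing.Theory Num.Theory.
Import numFieldNormedType.Exports.

Local Open Scope classical_set_scope.
Local Open Scope ring_scope.

(** A map [f] that is Gâteaux differentiable on an open set need not be
    continuous, but it is continuous along every line.  Hence a set defined by
    non-strict inequalities between values of [f] is closed along each
    coordinate axis, and this is enough for a Baire argument: if countably many
    separately closed sets cover a ball, one of them contains a smaller ball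
    ([separately_closed_baire]).

    A first use of it, with the sets of points at which [f] has a given
    Lipschitz constant along the axes, shows that every ball inside [G] contains
    a ball on which [f] is Lipschitz, hence Fréchet differentiable
    ([exists_differentiable_ball]).  So the exceptional set is nowhere dense.

    A second use, in the space of directions at a fixed point [x], shows that
    for each error [e] the Gâteaux expansion of [f] at [x] is uniform on some
    open cone of vertex [x], whose parameters can be taken in a countable set
    ([gateaux_cone_set]).  This covers [G] by countably many sets [A] of
    points that share a cone.  If [x] is in [A] and [A] is not porous at [x],
    any two points near [x] whose distance is small compared with their distance
    to [x] lie in the cone of one common vertex [z] of [A], and the expansion at
    [z] compares the values of [f] at them ([cone_set_not_porous]).  If this happens for
    arbitrarily small errors, the increments of [f] at [x] along neighbouring
    directions are comparable, and compactness of the unit ball upgrades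
    Gâteaux to Fréchet differentiability at [x] ([gateaux_frechet]).  So a point
    of the exceptional set is a porosity point of one of the sets [A] that
    contain it, and the porosity points of [A] that belong to [A] form a porous
    set. *)

(** * Sup norm estimates and rational approximation *)

Lemma coord_le_norm (R : realType) (n : nat) (v : 'rV[R]_n) (k : 'I_n) :
  `|v ord0 k| <= `|v|.
Proof.
rewrite [leRHS]/Num.Def.normr /= mx_normrE; apply/bigmax_geP; right => /=.
by exists (ord0, k).
Qed.

Lemma norm_lt_coord (R : realType) (n : nat) (v : 'rV[R]_n) (r : R) :
  0 < r -> (forall k, `|v ord0 k| < r) -> `|v| < r.
Proof.
move=> r0 vr; rewrite [ltLHS]/Num.Def.normr /= mx_normrE; apply/bigmax_ltP; split => //.
by move=> [i k] _ /=; rewrite (ord1 i).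
Qed.

Lemma norm_le_coord (R : realType) (n : nat) (v : 'rV[R]_n) (r : R) :
  0 <= r -> (forall k, `|v ord0 k| <= r) -> `|v| <= r.
Proof.
move=> r0 vr; rewrite [leLHS]/Num.Def.normr /= mx_normrE; apply/bigmax_leP; split => //.
by move=> [i k] _ /=; rewrite (ord1 i).
Qed.

Lemma archi_inv (R : realType) (r : R) :
  0 < r -> exists m : nat, m.+1%:R^-1 < r.
Proof.
move=> r0; exists (Num.truncn r^-1).
by rewrite invf_plt ?posrE ?ltr0n// truncnS_gt.
Qed.

Lemma rat_approx (R : realType) (n : nat) (z : 'rV[R]_n) (e : R) :
  0 < e -> exists q : 'rV[rat]_n, `|map_mx ratr q - z| < e.
Proof.
move=> e0.
have /fin_all_exists[q qP] (k : 'I_n) : exists q : rat, `|ratr q - z ord0 k| < e.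
  have /rat_in_itvoo[q] : z ord0 k - e < z ord0 k + e by lra.
  by rewrite in_itv /= => zq; exists q; rewrite ltr_distl.
exists (\row_k q k); apply: norm_lt_coord => // k.
by rewrite !mxE.
Qed.

(** * A Baire theorem for separately closed sets *)

(** The relative form of Baire's theorem: closedness is asked of the covering
    sets only inside [O], since they will be defined by conditions that make
    sense only there. *)
Lemma baire_open (R : realType) (V : completeNormedModType R) (I : countType)
    (O : set V) (T : I -> set V) :
  open O -> O !=set0 -> (forall a, O a -> exists i, T i a) ->
  (forall i a, O a -> closure (T i) a -> T i a) ->
  exists i, (O `&` T i)^° !=set0.
Proof.
move=> oO [c Oc] cov Tcl; apply: contrapT => noint.
pose A k := if unpickle k is Some i then O `&` T i else set0.
have /Baire : forall k, open (~` closure (A k)) /\ dense (~` closure (A k)).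
  move=> k; split; first exact/closed_openC/closed_closure.
  move=> U U0 oU; apply: contrapT => /set0P/negP; rewrite negbK => /eqP UA.
  have {}UA y : U y -> closure (A k) y.
    move=> Uy; apply: contrapT => nA.
    by have : (U `&` ~` closure (A k)) y by []; rewrite UA.
  rewrite /A in UA; case: (unpickle k : option I) UA => [i|] UA; last first.
    by case: U0 => y /UA; rewrite closure0.
  case: U0 => y Uy.
  have [z [[Oz Tz] Uz]] : (O `&` T i) `&` U !=set0.
    by apply: (UA _ Uy); exact: open_nbhs_nbhs.
  apply: noint; exists i, z; rewrite /interior nbhsE; exists (O `&` U).
    by split; [exact: openI | split].
  move=> w [Ow Uw]; split => //; apply: Tcl => //.
  by apply: closure_subset (UA _ Uw); exact: subIsetr.
move=> /(_ O); case; [by exists c | by []|] => x [Ox Ax].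
have [i Tx] := cov _ Ox.
by apply: (Ax (pickle i) Logic.I); rewrite /A pickleK; apply: subset_closure.
Qed.

(** Sets that are closed along each coordinate axis need not be closed, yet the
    conclusion of Baire's theorem survives.  The induction frees one coordinate
    at a time: when a box in the first [j] coordinates can be found in some
    [S i] for each value [a] of the next coordinate, it may be taken among
    countably many rational boxes, and for a fixed rational box the set of
    good [a] is closed because each [S i] is closed along that axis.  Baire's
    theorem on the line then gives an interval of good [a], hence a box in
    [j.+1] coordinates. *)
Lemma separately_closed_baire (R : realType) (n : nat) (I : countType)
    (S : I -> set 'rV[R]_n) (c : 'rV[R]_n) (rho : R) :
  0 < rho ->
  (forall x, `|x - c| < rho -> exists i, S i x) ->
  (forall i x (j : 'I_n), `|x - c| < rho ->
    (forall e, 0 < e -> exists s, `|s| < e /\ S i (x + s *: delta_mx ord0 j)) ->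
    S i x) ->
  exists i z r, 0 < r /\ forall y, `|y - z| < r -> `|y - c| < rho /\ S i y.
Proof.
move=> rho0 cov Scl.
suff claim (j : nat) : (j <= n)%N -> forall x : 'rV[R]_n, `|x - c| < rho ->
    exists i (z : 'rV[R]_n) r, [/\ 0 < r,
      forall k : 'I_n, (j <= k)%N -> z ord0 k = x ord0 k,
      forall y, `|y - z| < r -> `|y - c| < rho &
      forall y, `|y - z| < r ->
        (forall k : 'I_n, (j <= k)%N -> y ord0 k = x ord0 k) -> S i y].
  have [|i [z [r [r0 _ zrho zS]]]] := claim n (leqnn n) c.
    by rewrite subrr normr0.
  exists i, z, r; split => // y yz; split; first exact: zrho.
  by apply: zS => // k; rewrite leqNgt ltn_ord.
elim: j => [_ x xc|j IH jn x xc].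
  have [i Si] := cov _ xc.
  exists i, x, (rho - `|x - c|); split => //; first by rewrite subr_gt0.
    move=> y yx; rewrite -(subrK x y) -addrA.
    by rewrite (le_lt_trans (ler_normD _ _))// -ltrBrDr.
  by move=> y _ yx; suff -> : y = x by []; apply/rowP => k; exact: yx.
pose jo := Ordinal jn.
have coordlt (y : 'rV[R]_n) k : `|y - c| < rho -> `|y ord0 k - c ord0 k| < rho.
  by move=> yc; apply: le_lt_trans yc; have := coord_le_norm (y - c) k; rewrite !mxE.
have ltcoord (y : 'rV[R]_n) :
    (forall k, `|y ord0 k - c ord0 k| < rho) -> `|y - c| < rho.
  by move=> yc; apply: norm_lt_coord => // k; rewrite !mxE.
pose O : set R := [set a | `|a - c ord0 jo| < rho].
(* [T (i, q, m)] collects the values of coordinate [j] for which the whole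
   rational box of center [q] and half-width [1 / m.+1] in the previous
   coordinates lies in [S i]. *)
pose T (p : I * 'rV[rat]_n * nat) : set R := [set a | forall y : 'rV[R]_n,
  y ord0 jo = a -> (forall k : 'I_n, (j < k)%N -> y ord0 k = x ord0 k) ->
  (forall k : 'I_n, (k < j)%N -> `|y ord0 k - ratr (p.1.2 ord0 k)| < p.2.+1%:R^-1) ->
  `|y - c| < rho /\ S p.1.1 y].
have oO : open O.
  have -> : O = ball (c ord0 jo) rho.
    by apply/seteqP; split => a; rewrite -ball_normE /O /ball_ /= distrC.
  exact: ball_open.
have Ocov a : O a -> exists p, T p a.
  move=> Oa; pose xa : 'rV[R]_n := \row_k (if k == jo then a else x ord0 k).
  have xac : `|xa - c| < rho.
    by apply: ltcoord => k; rewrite mxE; case: eqP => [->|_]; [exact: Oa|exact: coordlt].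
  have [i [z [r [r0 zx zrho zS]]]] := IH (ltnW jn) _ xac.
  have [q qz] := rat_approx z (divr_gt0 r0 (ltr0Sn _ 1)).
  have [m mr] := archi_inv (divr_gt0 r0 (ltr0Sn _ 1)).
  exists (i, q, m) => y yj yx yq /=.
  have yxa (k : 'I_n) : (j <= k)%N -> y ord0 k = xa ord0 k.
    rewrite mxE leq_eqVlt => /predU1P[jk|jk].
      by have -> : k = jo; [exact: val_inj | rewrite eqxx].
    case: eqP => [kjo|_]; last exact: yx.
    by rewrite kjo ltnn in jk.
  have yz : `|y - z| < r.
    apply: norm_lt_coord => // k; rewrite !mxE.
    have [jk|kj] := leqP j k; first by rewrite yxa // zx // subrr normr0.
    have := le_lt_trans (coord_le_norm _ k) qz; rewrite !mxE => qzk.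
    have /= yqk := yq _ kj.
    rewrite (le_lt_trans (ler_distD (ratr (q ord0 k)) _ _))//.
    by rewrite [ltRHS]splitr ltrD// (lt_trans yqk).
  by split; [exact: zrho|exact: zS].
have Tcl p a : O a -> closure (T p) a -> T p a.
  move=> Oa cla y yj yx yq.
  have move_coord b : T p b -> `|y + (b - a) *: delta_mx ord0 jo - c| < rho /\
      S p.1.1 (y + (b - a) *: delta_mx ord0 jo).
    move=> Tb; apply: Tb => [|k jk|k kj].
    - by rewrite !mxE !eqxx /= mulr1 yj; ring.
    - rewrite !mxE /=.
      have -> : k == jo = false by apply/eqP => kjo; rewrite kjo ltnn in jk.
      by rewrite mulr0 addr0; exact: yx.
    - rewrite !mxE /=.
      have -> : k == jo = false by apply/eqP => kjo; rewrite kjo ltnn in kj.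
      by rewrite mulr0 addr0; exact: yq.
  have near_a e : 0 < e -> exists2 b, T p b & `|b - a| < e.
    move=> e0; have [b [Tb ab]] : T p `&` ball a e !=set0.
      by apply: cla; exact: nbhsx_ballx.
    by exists b => //; rewrite distrC.
  have yc : `|y - c| < rho.
    have [b /move_coord[yb _] _] := near_a 1 ltr01.
    apply: ltcoord => k; have [->|kjo] := eqVneq k jo; first by rewrite yj.
    have := coordlt _ k yb; rewrite !mxE /= (negbTE kjo) mulr0 addr0.
    exact.
  split => //; apply: (Scl _ _ jo) => // e e0.
  by have [b /move_coord[_ Sb] ba] := near_a e e0; exists (b - a).
(* The regular module [R^o] is [R] seen as a normed space over itself. *)
have [|p [b]] := @baire_open R R^o _ O T oO _ Ocov Tcl.
  by exists (c ord0 jo); rewrite /O /= subrr normr0.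
rewrite /interior => /nbhs_ballP[r /= r0 br].
have {}br a : `|a - b| < r -> T p a.
  by move=> ab; have [] := br a; rewrite // -ball_normE /= distrC.
case: p br => -[i q] m br.
have minv : 0 < m.+1%:R^-1 :> R by rewrite invr_gt0 ltr0n.
pose z : 'rV[R]_n := \row_k (if (k < j)%N then ratr (q ord0 k) else
   if k == jo then b else x ord0 k).
pose r' := Num.min (Num.min r m.+1%:R^-1) (rho - `|x - c|).
have r'0 : 0 < r' by rewrite !lt_min r0 minv subr_gt0.
have yz_T (y : 'rV[R]_n) : `|y - z| < r' -> 
    (forall k : 'I_n, (j < k)%N -> y ord0 k = x ord0 k) -> `|y - c| < rho /\ S i y.
  rewrite !lt_min => /andP[/andP[yr ym] yrho] yx.
  apply: (br (y ord0 jo)) => // [|k kj].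
    by have := le_lt_trans (coord_le_norm _ jo) yr; rewrite !mxE ltnn eqxx.
  by have := le_lt_trans (coord_le_norm _ k) ym; rewrite !mxE kj.
exists i, z, r'; split => //.
- move=> k jk; rewrite mxE ltnNge (ltnW jk) /=.
  by case: eqP => // kjo; rewrite kjo ltnn in jk.
- move=> y yz.
  (* Membership in the ball around [c] is known only for the points of the slice
     through [x]; both [y'], the projection of [y] to that slice, and [x] are in
     it, and each coordinate of [y] is controlled by one of the two. *)
  pose y' : 'rV[R]_n := \row_k (if (k <= j)%N then y ord0 k else x ord0 k).
  have [] := yz_T y'.
  + apply: norm_lt_coord => // k; rewrite !mxE.
    have [kj|jk] := leqP k j.
      by have := le_lt_trans (coord_le_norm _ k) yz; rewrite !mxE.
    rewrite ltnNge (ltnW jk) /=.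
    case: eqP => [kjo|_]; last by rewrite subrr normr0.
    by rewrite kjo ltnn in jk.
  + by move=> k jk; rewrite mxE leqNgt jk.
  move=> y'c _; apply: ltcoord => k.
  have [kj|jk] := leqP k j.
    by have := coordlt _ k y'c; rewrite !mxE kj.
  have := le_lt_trans (coord_le_norm _ k) yz; rewrite !mxE ltnNge (ltnW jk) /=.
  have -> : k == jo = false by apply/eqP => kjo; rewrite kjo ltnn in jk.
  rewrite !lt_min => /andP[_]; rewrite ltrBrDr => yx; apply: le_lt_trans yx.
  have xck := coord_le_norm (x - c) k; rewrite !mxE in xck.
  by rewrite (le_trans (ler_distD (x ord0 k) _ _))// lerD2l.
- by move=> y yz yx; have [] := yz_T y yz yx.
Qed.

(** * Gâteaux and Fréchet derivatives in epsilon-delta form *)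

Lemma gateaux_epsilon (R : realType) (V Y : normedModType R) (f : V -> Y) (x : V) :
  gateaux_differentiable f x ->
  exists (L : {linear V -> Y}) (K : R), [/\ 0 < K, forall h, `|L h| <= K * `|h| &
    forall v e, 0 < e -> exists2 d, 0 < d &
      forall t, `|t| < d -> `|f (x + t *: v) - f x - t *: L v| <= e * `|t|].
Proof.
move=> [L [Lc Lx]].
have [K K0 LK] : exists2 K : R, 0 < K & forall h, `|L h| <= K * `|h|.
  by apply: pinfty_ex_gt0; apply/linear_boundedP/linear_bounded_continuous.
exists L, K; split => // v e e0.
have /cvgrPdistC_le/(_ _ e0) := Lx v.
rewrite /= near_withinE => /nbhs_normP[d /= d0 dL]; exists d => // t td.
have [->|t0] := eqVneq t 0; first by rewrite !scale0r addr0 !subrr !normr0 mulr0.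
have -> : f (x + t *: v) - f x - t *: L v =
    t *: (t^-1 *: (f (x + t *: v) - f x) - L v).
  by rewrite scalerBr scalerA divff// scale1r.
rewrite normrZ mulrC ler_wpM2r//; apply: dL => //=.
by rewrite sub0r normrN.
Qed.

Lemma gateaux_continuous_line (R : realType) (V Y : normedModType R)
    (f : V -> Y) (x v : V) (e : R) :
  gateaux_differentiable f x -> 0 < e ->
  exists2 d, 0 < d & forall t, `|t| < d -> `|f (x + t *: v) - f x| <= e.
Proof.
move=> /gateaux_epsilon[L [K [K0 LK Lx]]] e0.
have [d d0 dL] := Lx v 1 ltr01.
have c0 : 0 < 1 + `|L v| by rewrite ltr_pwDl.
exists (Num.min d (e / (1 + `|L v|))); first by rewrite lt_min d0 divr_gt0.
move=> t; rewrite lt_min ltr_pdivlMr// => /andP[td te].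
rewrite -(subrK (t *: L v) (f (x + t *: v) - f x)).
rewrite (le_trans (ler_normD _ _))// (le_trans _ (ltW te))//.
by rewrite mulrDr mulr1 normrZ lerD2r (le_trans (dL _ td))// mul1r.
Qed.

Lemma frechet_criterion (R : realType) (V Y : normedModType R)
    (f : V -> Y) (x : V) (L : {linear V -> Y}) :
  continuous L ->
  (forall e, 0 < e -> exists2 d, 0 < d &
    forall h, `|h| < d -> `|f (x + h) - f x - L h| <= e * `|h|) ->
  differentiable f x.
Proof.
move=> Lc Lx.
have fL : f \o shift x = cst (f x) + L +o_ 0 id.
  apply/eqaddoP => e e0; apply/nbhs_normP; have [d d0 dL] := Lx _ e0.
  exists d => //= h /=; rewrite sub0r normrN => /dL.
  by rewrite -[X in _ -> `|X| <= _]/(f (h + x) - (f x + L h)) opprD addrA [h + x]addrC.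
by apply/diff_locallyP; rewrite (diff_unique Lc fL).
Qed.

(** Gâteaux differentiability controls the increments of [f] along each fixed
    direction, with a threshold that depends on the direction.  The second
    hypothesis says that increments [a], [b] that are close relative to their
    size [t] give close values of [f] relative to [t]; it passes the control
    from a direction to its neighbours, and compactness of the unit ball makes
    the threshold uniform. *)
Lemma gateaux_frechet (R : realType) (n : nat) (Y : normedModType R)
    (f : 'rV[R]_n -> Y) (x : 'rV[R]_n) :
  gateaux_differentiable f x ->
  (forall e, 0 < e -> exists eta d, [/\ 0 < eta, 0 < d &
    forall a b t, t < d -> `|a| <= t -> `|b| <= t -> `|a - b| <= eta * t ->
      `|f (x + a) - f (x + b)| <= e * t]) ->
  differentiable f x.
Proof.
move=> gx lipx; have [L [K [K0 LK Lx]]] := gateaux_epsilon gx.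
have Lc : continuous L.
  apply/linear_bounded_continuous/linear_boundedP.
  exists K; split; first by rewrite gtr0_real.
  by move=> r Kr h; rewrite (le_trans (LK h))// ler_wpM2r// ltW.
apply: (frechet_criterion Lc) => e e0.
have cB : compact [set w : 'rV[R]_n | `|w| <= 1].
  apply: bounded_closed_compact.
    by exists 1; split => // M M1 w /= w1; exact: le_trans w1 (ltW M1).
  have -> : [set w : 'rV[R]_n | `|w| <= 1] = Num.norm @^-1` [set r | r <= 1] by [].
  by apply: preimage_closed; [move=> w _; exact: norm_continuous | exact: closed_le].
have [eta [d [eta0 d0 lip]]] := lipx (e / 3) ltac:(lra).
pose P (t : R) (w : 'rV[R]_n) :=
  `|w| <= 1 -> `|f (x + t *: w) - f x - t *: L w| <= e * t.
have : \forall t \near (0 : R)^'+, [set w : 'rV[R]_n | `|w| <= 1] `<=` P t.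
  have /compact_near_coveringP := cB.
  apply => v /= v1.
  have [d' d'0 dL] := Lx v (e / 3) ltac:(lra).
  have r0 : 0 < Num.min eta (e / 3 / K) by rewrite lt_min eta0 !divr_gt0.
  have nearv : \forall u \near v, `|v - u| < Num.min eta (e / 3 / K).
    by apply/nbhs_ballP; exists (Num.min eta (e / 3 / K)) => // u; rewrite -ball_normE.
  near=> w t => /= w1.
  have t0 : 0 < t by near: t; exact: nbhs_right_gt.
  have td : t < d by near: t; exact: nbhs_right_lt.
  have td' : `|t| < d' by rewrite gtr0_norm//; near: t; exact: nbhs_right_lt.
  have : `|w - v| < Num.min eta (e / 3 / K).
    by rewrite distrC; near: w; exact: nearv.
  rewrite lt_min => /andP[weta wK].
  have normtv (u : 'rV[R]_n) : `|u| <= 1 -> `|t *: u| <= t.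
    by move=> u1; rewrite normrZ gtr0_norm// ler_piMr// ltW.
  have twv : `|t *: w - t *: v| <= eta * t.
    by rewrite -scalerBr normrZ gtr0_norm// mulrC ler_wpM2r// ltW.
  have := lip _ _ _ td (normtv _ w1) (normtv _ v1) twv.
  have := dL _ td'; rewrite gtr0_norm// => A1 A2.
  have A3 : `|t *: L v - t *: L w| <= e / 3 * t.
    rewrite -scalerBr -linearB normrZ gtr0_norm// mulrC ler_wpM2r ?ltW//.
    by rewrite (le_lt_trans (LK _))// distrC mulrC -ltr_pdivlMr.
  have -> : f (x + t *: w) - f x - t *: L w = (f (x + t *: w) - f (x + t *: v)) +
      (f (x + t *: v) - f x - t *: L v) + (t *: L v - t *: L w).
    rewrite -(addrA (f (x + t *: v))) subrKA.
    by rewrite (addrA (f (x + t *: w))) subrKA.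
  rewrite (le_trans (ler_normD _ _))//.
  rewrite (le_trans (lerD (ler_normD _ _) (lexx _)))//.
  by have := lerD (lerD A2 A1) A3; lra.
rewrite near_withinE => /nbhs_normP[r /= r0 rP]; exists r => // h hr.
have [->|h0] := eqVneq h 0; first by rewrite addr0 linear0 !subrr !normr0 mulr0.
have h0' : 0 < `|h| by rewrite normr_gt0.
have hE : `|h| *: (`|h|^-1 *: h) = h by rewrite scalerA divff ?scale1r// gt_eqF.
have h1 : `| `|h|^-1 *: h | <= 1 by rewrite normrZ normfV normr_id mulVf ?gt_eqF.
have := rP `|h|; rewrite /= sub0r normrN normr_id => /(_ hr h0' _ h1 h1).
by rewrite hE -linearZ hE.
Unshelve. all: by end_near. Qed.

(** * Uniformity of the Gâteaux derivative on a cone *)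

(** Gâteaux differentiability at [x] up to the error [e], made uniform on the
    truncated cone of vertex [x] over the ball of center [q].  A single [k]
    bounds the radius, the height and the linear part, and [q] is rational, so
    that the parameters range over a countable set. *)
Definition cone_set (R : realType) (n : nat) (Y : normedModType R)
    (f : 'rV[R]_n -> Y) (e : R) (k : nat) (q : 'rV[rat]_n) : set 'rV[R]_n :=
  [set x | exists L : {linear 'rV[R]_n -> Y},
    (forall h, `|L h| <= k.+1%:R * `|h|) /\
    forall w t, `|w - map_mx ratr q| < k.+1%:R^-1 -> 0 < t -> t < k.+1%:R^-1 ->
      `|f (x + t *: w) - f x - t *: L w| <= e * t].

(** A Gâteaux differentiable map need not be continuous, so the sets [S i] of
    directions in which the expansion holds up to [d / i.+1] need not be closed.
    But [f] is continuous along every line, so they are separately closed and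
    one of them contains a ball. *)
Lemma gateaux_cone_set (R : realType) (n : nat) (Y : normedModType R)
    (G : set 'rV[R]_n) (f : 'rV[R]_n -> Y) (x : 'rV[R]_n) (e : R) :
  open G -> (forall x, G x -> gateaux_differentiable f x) -> G x -> 0 < e ->
  exists k q, cone_set f e k q x.
Proof.
move=> oG gG Gx e0.
have [d d0 dG] : exists2 d, 0 < d & forall y, `|y - x| < d -> G y.
  have /nbhs_ballP[d /= d0 dG] := open_nbhs_nbhs (conj oG Gx).
  by exists d => // y yx; apply: dG; rewrite -ball_normE /= distrC.
have [L [K [K0 LK Lx]]] := gateaux_epsilon (gG _ Gx).
(* The factor [d] keeps [x + t *: w] inside [G] for [w] in the unit ball. *)
pose S (i : nat) : set 'rV[R]_n := [set w | forall t, 0 < t -> t < d / i.+1%:R ->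
  `|f (x + t *: w) - f x - t *: L w| <= e * t].
have [||i [z [r [r0 zS]]]] := @separately_closed_baire R n _ S 0 1 ltr01.
- move=> w _; have [d' d'0 dL] := Lx w e e0.
  have [i id] := archi_inv (divr_gt0 d'0 d0).
  exists i => t t0 ti; have := dL t; rewrite gtr0_norm//; apply.
  by rewrite (lt_trans ti)// mulrC -ltr_pdivlMr.
- move=> i w j; rewrite subr0 => w1 wS t t0 ti.
  apply/ler_addgt0Pl => eps eps0.
  have Gw : G (x + t *: w).
    apply: dG; rewrite addrAC subrr add0r normrZ gtr0_norm//.
    have i1 : 1 <= i.+1%:R :> R by rewrite ler1n.
    have td : t < d by rewrite (lt_le_trans ti)// ler_pdivrMr// ler_peMr// ltW.
    by rewrite (le_lt_trans _ td)// ler_piMr// ltW.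
  set u : 'rV[R]_n := delta_mx ord0 j in wS *.
  have [d1 d10 fc] := gateaux_continuous_line (t *: u) (gG _ Gw)
    (divr_gt0 eps0 (ltr0Sn _ 1)).
  have c0 : 0 < t * (1 + `|L u|) by rewrite mulr_gt0// ltr_pwDl.
  have [|s [sd Ss]] := wS (Num.min d1 (eps / 2 / (t * (1 + `|L u|)))).
    by rewrite lt_min d10 divr_gt0// divr_gt0.
  move: sd; rewrite lt_min ltr_pdivlMr// => /andP[sd1 sd2].
  have := Ss t t0 ti; have := fc s sd1.
  have -> : x + t *: (w + s *: u) = x + t *: w + s *: (t *: u).
    by rewrite scalerDr addrA !scalerA mulrC.
  move=> A1 A2.
  have A3 : `|t *: L (s *: u)| <= eps / 2.
    rewrite linearZ /= !normrZ gtr0_norm// (le_trans _ (ltW sd2))//.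
    by rewrite mulrCA ler_wpM2l// ler_pM2l// lerDr.
  set F := f (x + t *: w + s *: (t *: u)) in A1 A2.
  have -> : f (x + t *: w) - f x - t *: L w =
      (f (x + t *: w) - F) + (F - f x - t *: L (w + s *: u)) + t *: L (s *: u).
    rewrite linearD scalerDr opprD -(addrA F) subrKA !addrA.
    by rewrite subrK.
  rewrite (le_trans (ler_normD _ _))//.
  rewrite (le_trans (lerD (ler_normD _ _) (lexx _)))// [`|f _ - F|]distrC.
  by have := lerD (lerD A1 A2) A3; lra.
have [q qz] := rat_approx z (divr_gt0 r0 (ltr0Sn _ 1)).
have m0 : 0 < Num.min (Num.min (r / 2) (d / i.+1%:R)) K^-1.
  by rewrite !lt_min !divr_gt0//= invr_gt0.
have [k] := archi_inv m0; rewrite !lt_min => /andP[/andP[kr kd] kK].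
exists k, q, L; split.
  move=> h; rewrite (le_trans (LK h))// ler_wpM2r// ltW//.
  by rewrite -ltf_pV2 ?posrE.
move=> w t wq t0 tk; have [_] : `|w - 0| < 1 /\ S i w.
  apply: zS; rewrite (le_lt_trans (ler_distD (map_mx ratr q) _ _))//.
  by rewrite [ltRHS]splitr ltrD// (lt_trans wq).
by apply => //; exact: lt_trans tk kd.
Qed.

(** * Fréchet differentiability on a dense open set *)

(** In the sup norm a path that replaces the coordinates of [a] by those of [b]
    one by one stays in the ball; each of its [n] steps costs [K * |b - a|]. *)
Lemma coord_lipschitz (R : realType) (n : nat) (Y : normedModType R)
    (f : 'rV[R]_n -> Y) (z : 'rV[R]_n) (r K : R) :
  (forall y (j : 'I_n) t, `|y - z| < r -> `|y + t *: delta_mx ord0 j - z| < r ->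
    `|f (y + t *: delta_mx ord0 j) - f y| <= K * `|t|) ->
  0 <= K ->
  forall a b, `|a - z| < r -> `|b - z| < r -> `|f b - f a| <= n%:R * K * `|b - a|.
Proof.
move=> fK K0 a b az bz.
pose c (j : nat) : 'rV[R]_n := \row_k (if (k < j)%N then b ord0 k else a ord0 k).
have cz j : `|c j - z| < r.
  apply: norm_lt_coord; first exact: le_lt_trans az.
  move=> k; rewrite !mxE; case: ifP => _.
    by apply: le_lt_trans bz; have := coord_le_norm (b - z) k; rewrite !mxE.
  by apply: le_lt_trans az; have := coord_le_norm (a - z) k; rewrite !mxE.
have c0 : c 0%N = a by apply/rowP => k; rewrite mxE.
have cn : c n = b by apply/rowP => k; rewrite mxE ltn_ord.
suff path j : (j <= n)%N -> `|f (c j) - f a| <= j%:R * K * `|b - a|.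
  by rewrite -{1}cn path.
elim: j => [_|j IH jn]; first by rewrite c0 subrr normr0 !mul0r.
rewrite (le_trans (ler_distD (f (c j)) _ _))//.
rewrite -natr1 mulrDl mul1r mulrDl addrC lerD//; first exact/IH/ltnW.
pose jo := Ordinal jn.
have cS : c j.+1 = c j + (b ord0 jo - a ord0 jo) *: delta_mx ord0 jo.
  apply/rowP => k; rewrite !mxE /= ltnS leq_eqVlt.
  have [->|kjo] := eqVneq k jo; first by rewrite /= eqxx ltnn mulr1 addrC subrK.
  by rewrite -val_eqE /= in kjo; rewrite (negbTE kjo) /= mulr0 addr0.
rewrite cS (le_trans (fK _ _ _ _ _))// -?cS// ler_wpM2l//.
by have := coord_le_norm (b - a) jo; rewrite !mxE.
Qed.

(** Each point admits a Lipschitz constant for small moves along the axes.  The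
    points that share a constant form a separately closed set, so some constant
    serves a whole ball, where [f] is then Lipschitz; and Lipschitz maps satisfy
    the second hypothesis of [gateaux_frechet]. *)
Lemma exists_differentiable_ball (R : realType) (n : nat) (Y : normedModType R)
    (f : 'rV[R]_n -> Y) (c : 'rV[R]_n) (rho : R) :
  0 < rho -> (forall x, `|x - c| < rho -> gateaux_differentiable f x) ->
  exists z r, 0 < r /\ forall y, `|y - z| < r -> `|y - c| < rho /\ differentiable f y.
Proof.
move=> rho0 gf.
pose d (i : nat) := rho / 2 / i.+1%:R.
have rho2 : 0 < rho / 2 by rewrite divr_gt0.
have d0 i : 0 < d i by rewrite divr_gt0.
pose S (i : nat) : set 'rV[R]_n := [set y | forall (j : 'I_n) t, `|t| < d i ->
  `|f (y + t *: delta_mx ord0 j) - f y| <= i.+1%:R * `|t|].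
have delta1 (j : 'I_n) : `|delta_mx ord0 j : 'rV[R]_n| <= 1.
  by apply: norm_le_coord => // k; rewrite !mxE; case: (_ && _); rewrite ?normr1 ?normr0.
have [|||i [z [r [r0 zS]]]] := @separately_closed_baire R n _ S c (rho / 2).
- exact: rho2.
- move=> y yc.
  have [|L [K [K0 LK Ly]]] := @gateaux_epsilon _ _ _ f y.
    by apply: gf; rewrite (lt_trans yc)// gtr_pMr// invf_lt1// ltr1n.
  have /fin_all_exists[i iP] (j : 'I_n) : exists i : nat, forall t, `|t| < d i ->
      `|f (y + t *: delta_mx ord0 j) - f y| <= i.+1%:R * `|t|.
    have [d' d'0 dL] := Ly (delta_mx ord0 j) 1 ltr01.
    have m0 : 0 < Num.min (d' / (rho / 2)) (1 + K)^-1.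
      by rewrite lt_min !divr_gt0//= invr_gt0 addr_gt0.
    have [i] := archi_inv m0; rewrite lt_min => /andP[id iK].
    exists i => t ti; have td : `|t| < d'.
      by rewrite (lt_trans ti)// /d mulrC -ltr_pdivlMr// divr_gt0.
    rewrite -(subrK (t *: L (delta_mx ord0 j)) (f _ - f y)).
    rewrite (le_trans (ler_normD _ _))// (le_trans (lerD (dL _ td) (lexx _)))//.
    rewrite normrZ mulrC -mulrDr mulrC ler_wpM2r//.
    rewrite (@le_trans _ _ (1 + K))//.
      by rewrite lerD2l (le_trans (LK _))// ler_piMr// ltW.
    by rewrite -lef_pV2 ?posrE ?addr_gt0// ltW.
  exists (\max_j i j) => j t td.
  have ij : (i j <= \max_j i j)%N by exact: leq_bigmax.
  rewrite (le_trans (iP j t _))//.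
    by rewrite (lt_le_trans td)// /d ler_pM2l// lef_pV2 ?posrE ?ler_nat.
  by rewrite ler_wpM2r// ler_nat.
- move=> i y j yc yS k t td.
  apply/ler_addgt0Pl => eps eps0.
  have eps2 := divr_gt0 eps0 (ltr0Sn R 1).
  have gyt : gateaux_differentiable f (y + t *: delta_mx ord0 k).
    apply: gf; rewrite addrAC (le_lt_trans (ler_normD _ _))// [ltRHS]splitr ltrD//.
    rewrite normrZ (@le_lt_trans _ _ `|t|)// ?ler_piMr// (lt_le_trans td)//.
    by rewrite ler_pdivrMr// ler_peMr ?ler1n// (ltW rho2).
  have gy : gateaux_differentiable f y.
    by apply: gf; rewrite (lt_trans yc)// gtr_pMr// invf_lt1// ltr1n.
  have [d1 d10 fc1] := gateaux_continuous_line (delta_mx ord0 j) gyt eps2.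
  have [d2 d20 fc2] := gateaux_continuous_line (delta_mx ord0 j) gy eps2.
  have [|s [sd Ss]] := yS (Num.min d1 d2); first by rewrite lt_min d10.
  move: sd; rewrite lt_min => /andP[/fc1 A1 /fc2 A2].
  have A3 := Ss k t td; rewrite addrAC in A3.
  set F := f (y + t *: delta_mx ord0 k) in A1 *.
  set F' := f (y + t *: delta_mx ord0 k + s *: delta_mx ord0 j) in A1 A3.
  set F'' := f (y + s *: delta_mx ord0 j) in A2 A3.
  have -> : F - f y = (F - F') + (F' - F'') + (F'' - f y) by rewrite subrKA subrKA.
  rewrite (le_trans (ler_normD _ _))//.
  rewrite (le_trans (lerD (ler_normD _ _) (lexx _)))// [`|F - _|]distrC.
  by have := lerD (lerD A1 A3) A2; lra.
(* Two points of the smaller ball differ by less than [d i] in each coordinate,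
   so the bound defining [S i] applies to them. *)
pose r' := Num.min r (d i / 2).
have r'0 : 0 < r' by rewrite lt_min r0 divr_gt0.
have lip : forall a b, `|a - z| < r' -> `|b - z| < r' ->
    `|f b - f a| <= n%:R * i.+1%:R * `|b - a|.
  apply: coord_lipschitz => // y j t; rewrite !lt_min => /andP[yr yd] /andP[_ td].
  apply: (zS y yr).2.
  have -> : t = (y + t *: delta_mx ord0 j - y) ord0 j.
    by rewrite !mxE !eqxx mulr1 addrAC subrr add0r.
  rewrite (le_lt_trans (coord_le_norm _ _))//.
  rewrite (le_lt_trans (ler_distD z _ _))// [ltRHS]splitr ltrD// distrC.
  by [].
exists z, r'; split => // y yz.
have yc : `|y - c| < rho / 2.
  by apply: (zS y _).1; rewrite (lt_le_trans yz)// ge_min lexx.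
have ycr : `|y - c| < rho by rewrite (lt_trans yc)// gtr_pMr// invf_lt1// ltr1n.
split => //; apply: gateaux_frechet; first exact: gf.
move=> e e0.
have M0 : 0 < n%:R * i.+1%:R + 1 :> R by rewrite ltr_wpDl// mulr_ge0.
exists (e / (n%:R * i.+1%:R + 1)), (r' - `|y - z|); split; rewrite ?divr_gt0 ?subr_gt0//.
move=> a b t td ta tb tab.
have t0 : 0 <= t by exact: le_trans ta.
have near_z h : `|h| <= t -> `|y + h - z| < r'.
  move=> ht; rewrite addrAC (le_lt_trans (ler_normD _ _))//.
  by rewrite -ltrBrDl (le_lt_trans ht).
rewrite (le_trans (lip _ _ (near_z _ tb) (near_z _ ta)))//.
rewrite opprD addrACA subrr add0r.
rewrite (@le_trans _ _ ((n%:R * i.+1%:R + 1) * `|a - b|))//.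
  by rewrite ler_wpM2r// lerDl.
by rewrite mulrC -ler_pdivlMr// mulrAC.
Qed.

(** * Porosity *)

Lemma norm_le_enorm (R : realType) (n : nat) (v : 'rV[R]_n) : `|v| <= enorm v.
Proof.
apply: norm_le_coord; first exact: sqrtr_ge0.
move=> k; rewrite -sqrtr_sqr ler_wsqrtr// (bigD1 k)//= lerDl.
by apply: sumr_ge0 => i _; exact: sqr_ge0.
Qed.

Lemma enorm_le_norm (R : realType) (n : nat) (v : 'rV[R]_n) :
  enorm v <= n.+1%:R * `|v|.
Proof.
have v0 : 0 <= n.+1%:R * `|v| by rewrite mulr_ge0.
rewrite -(ger0_norm v0) -sqrtr_sqr ler_wsqrtr// exprMn.
rewrite (@le_trans _ _ (\sum_(i < n) `|v| ^+ 2))//.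
  apply: ler_sum => k _; rewrite -real_normK ?num_real//.
  by rewrite lerXn2r ?nnegrE//; exact: coord_le_norm.
rewrite sumr_const card_ord -[leLHS]mulr_natl ler_wpM2r ?sqr_ge0// -natrX ler_nat.
by rewrite (leq_trans (leqnSn n))// -[leqLHS]muln1 leq_mul.
Qed.

Lemma porous_at_subset (R : realType) (n : nat) (A B : set 'rV[R]_n) (x : 'rV[R]_n) :
  A `<=` B -> porous_at B x -> porous_at A x.
Proof.
move=> AB [p [p0 [y [yx ynx yB]]]]; exists p; split => //; exists y; split => // k.
by apply/seteqP; split => // w [yw Aw]; rewrite -(yB k); split => //; exact: AB.
Qed.

(** The ratio [p] in the Euclidean norm is traded for one in the sup norm at the
    cost of the factor [n.+1] from [enorm_le_norm]. *)
Lemma not_porous_at_norm (R : realType) (n : nat) (A : set 'rV[R]_n)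
    (x : 'rV[R]_n) (p : R) :
  A x -> ~ porous_at A x -> 0 < p ->
  exists2 d, 0 < d & forall y, `|y - x| < d ->
    exists2 z, A z & `|z - y| <= p * `|y - x|.
Proof.
move=> Ax nporous p0; apply: contrapT => nd; apply: nporous.
have q0 : 0 < p / n.+1%:R by rewrite divr_gt0.
exists (p / n.+1%:R); split => //.
have /choice[y yP] (k : nat) : exists y : 'rV[R]_n, [/\ `|y - x| < k.+1%:R^-1,
    y != x & eball y (p / n.+1%:R * enorm (y - x)) `&` A = set0].
  apply: contrapT => ny; apply: nd; exists k.+1%:R^-1; first by rewrite invr_gt0.
  move=> y yx; have [->|ynx] := eqVneq y x.
    by exists x => //; rewrite subrr normr0 mulr0.
  apply: contrapT => nz; apply: ny; exists y; split => //.
  apply/seteqP; split => // z [zy Az]; apply: nz; exists z => //.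
  rewrite (le_trans (norm_le_enorm _))// (le_trans (ltW zy))//.
  rewrite (le_trans (ler_wpM2l (ltW q0) (enorm_le_norm _)))//.
  by rewrite mulrA divfK// pnatr_eq0.
exists y; split => [|k|k]; try by have [] := yP k.
apply/cvgrPdistC_le => e e0; have [m me] := archi_inv e0.
exists m => //= k mk; have [yk _ _] := yP k.
rewrite (le_trans (ltW yk))// (le_trans _ (ltW me))//.
by rewrite lef_pV2 ?posrE ?ler_nat.
Qed.

(** Let [x + a] and [x + b] be two nearby points at distance about [t] from [x].
    Since the cone set [A] is not porous at [x], there is [z] in [A] so close to
    [x + a - t *: q] that both points lie in the cone of vertex [z], at height
    [t].  The expansion of [f] at [z] then compares their values: two errors
    [e * t], plus the effect of the linear part on the small vector [a - b]. *)
Lemma cone_set_not_porous (R : realType) (n : nat) (Y : normedModType R)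
    (f : 'rV[R]_n -> Y) (e : R) (k : nat) (q : 'rV[rat]_n) (x : 'rV[R]_n) :
  0 < e -> cone_set f e k q x -> ~ porous_at (cone_set f e k q) x ->
  exists eta d, [/\ 0 < eta, 0 < d &
    forall a b t, t < d -> `|a| <= t -> `|b| <= t -> `|a - b| <= eta * t ->
      `|f (x + a) - f (x + b)| <= 3 * e * t].
Proof.
move=> e0 Ax nA; set v : 'rV[R]_n := map_mx ratr q.
set r : R := k.+1%:R^-1; have r0 : 0 < r by rewrite invr_gt0.
have v0 : 0 < 1 + `|v| by rewrite ltr_pwDl.
have p0 : 0 < r / 3 / (1 + `|v|) by rewrite !divr_gt0.
have [d d0 dA] := not_porous_at_norm Ax nA p0.
(* With these constants [(x + a - z) / t] and [(x + b - z) / t] differ from [v]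
   by at most [2 * r / 3]: one third of [r] from [z], one from [a - b]. *)
have dv : 0 < d / (1 + `|v|) by rewrite divr_gt0.
exists (Num.min (r / 3) (e * r)), (Num.min r (d / (1 + `|v|))); split.
- by rewrite lt_min !(divr_gt0, mulr_gt0).
- by rewrite lt_min r0.
move=> a b t; rewrite lt_min => /andP[tr td] ta tb tab.
have : 0 <= t by exact: le_trans ta.
rewrite le_eqVlt => /predU1P[t0|t0].
  move: ta tb; rewrite -t0 !normr_le0 => /eqP -> /eqP ->.
  by rewrite subrr normr0 mulr0.
pose y := x + a - t *: v.
have yx : `|y - x| <= t * (1 + `|v|).
  have -> : y - x = a - t *: v by apply/rowP => i; rewrite !mxE; ring.
  by rewrite (le_trans (ler_normB _ _))// mulrDr mulr1 normrZ gtr0_norm// lerD2r.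
have [|z [L [LK Lz]] zy] := dA y.
  by rewrite (le_lt_trans yx)// -ltr_pdivlMr.
have {}zy : `|y - z| <= r / 3 * t.
  rewrite distrC (le_trans zy)// (le_trans (ler_wpM2l (ltW p0) yx))//.
  by rewrite mulrCA divfK ?gt_eqF// mulrC.
have est (h : 'rV[R]_n) : `|h - a| <= r / 3 * t ->
    `|f (x + h) - f z - L (x + h - z)| <= e * t.
  move=> ha; pose w := t^-1 *: (x + h - z).
  have hE : t *: w = x + h - z by rewrite scalerA divff ?scale1r// gt_eqF.
  have := Lz w t; rewrite -[t *: L w]linearZ hE [z + _]addrC subrK.
  apply => //; rewrite -/v.
  have -> : w - v = t^-1 *: ((h - a) + (y - z)).
    have -> : h - a + (y - z) = x + h - z - t *: v.
      by apply/rowP => i; rewrite !mxE; ring.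
    by rewrite [in RHS]scalerBr scalerA mulVf ?scale1r// gt_eqF.
  rewrite normrZ gtr0_norm ?invr_gt0// ltr_pdivrMl// (le_lt_trans (ler_normD _ _))//.
  rewrite (le_lt_trans (lerD ha zy))//.
  by rewrite -/r; have := mulr_gt0 r0 t0; lra.
have tab1 : `|b - a| <= r / 3 * t.
  by rewrite distrC (le_trans tab)// ler_pM2r// ge_min lexx.
have A1 : `|f (x + a) - f z - L (x + a - z)| <= e * t.
  by apply: est; rewrite subrr normr0 mulr_ge0// ltW// divr_gt0.
have A2 := est _ tab1.
have A3 : `|L (a - b)| <= e * t.
  rewrite (le_trans (LK _))// mulrC -ler_pdivlMr// -/r (le_trans tab)//.
  by rewrite mulrAC ler_pM2r// ge_min lexx orbT.
have -> : f (x + a) - f (x + b) = (f (x + a) - f z - L (x + a - z)) -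
    (f (x + b) - f z - L (x + b - z)) + L (a - b).
  have -> : L (a - b) = L (x + a - z) - L (x + b - z).
    by rewrite -linearB; congr (L _); apply/rowP => i; rewrite !mxE; ring.
  by rewrite addrACA subrK -opprD subrK opprB subrKA.
rewrite (le_trans (ler_normD _ _))//.
rewrite (le_trans (lerD (ler_normB _ _) (lexx _)))//.
by have := lerD (lerD A1 A2) A3; lra.
Qed.

(** * The exceptional set *)

Theorem theorem3p12 (R : realType) (n : nat) (Y : completeNormedModType R)
    (G : set 'rV[R]_n) (f : 'rV[R]_n -> Y)
    (openG : open G)
    (gateauxf : forall x, G x -> gateaux_differentiable f x) :
  let N := [set x | G x /\ ~ differentiable f x] in
  nowhere_dense N /\ sigma_porous N.
Proof.
move=> N; split.
  rewrite /nowhere_dense -subset0 => c /nbhs_ballP[r /= r0 rN].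
  have [x [[Gx _] xc]] : N `&` ball c r !=set0.
    by apply: (rN c (ballxx _ r0)); exact: nbhsx_ballx.
  have /nbhs_ballP[rho /= rho0 rhoGN] : nbhs x (G `&` ball c r).
    by apply: open_nbhs_nbhs; split; [apply: openI => //; exact: ball_open|].
  have {}rhoGN y : `|y - x| < rho -> G y /\ closure N y.
    move=> yx; have [] := rhoGN y; first by rewrite -ball_normE /= distrC.
    by move=> Gy /rN.
  have [|z [s [s0 sP]]] := @exists_differentiable_ball _ _ _ f x rho rho0.
    by move=> y /rhoGN[Gy _]; exact: gateauxf.
  have [zx _] : `|z - x| < rho /\ differentiable f z.
    by apply: sP; rewrite subrr normr0.
  have [y [[_ ndy] zy]] : N `&` ball z s !=set0.
    by apply: (rhoGN z zx).2; exact: nbhsx_ballx.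
  by apply: ndy; apply: (sP y _).2; rewrite distrC; rewrite -ball_normE in zy.
(* The exceptional set is covered by the sets of porosity points of the countably
   many cone sets with error [1 / m.+1]. *)
pose A (p : nat * nat * 'rV[rat]_n) :=
  cone_set f p.1.1.+1%:R^-1 p.1.2 p.2.
pose P p := [set x | [/\ N x, A p x & porous_at (A p) x]].
exists (fun i => if unpickle i is Some p then P p else set0); split.
  move=> i; case: (unpickle i) => [p|] // x [_ _ Ax].
  by apply: porous_at_subset Ax => y [].
apply/seteqP; split => x; last first.
  by move=> [i _]; case: (unpickle i) => [p|] // [].
move=> Nx; apply: contrapT => nP.
have {}nP p : A p x -> ~ porous_at (A p) x.
  by move=> Ap pA; apply: nP; exists (pickle p) => //; rewrite pickleK.
case: Nx => Gx; apply; apply: gateaux_frechet; first exact: gateauxf.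
move=> e e0; have [m me] := archi_inv (divr_gt0 e0 (ltr0Sn _ 2)).
have m0 : 0 < m.+1%:R^-1 :> R by rewrite invr_gt0.
have [k [q Ax]] := gateaux_cone_set openG gateauxf Gx m0.
have [eta [d [eta0 d0 lip]]] := cone_set_not_porous m0 Ax (nP (m, k, q) Ax).
exists eta, d; split => // a b t td ta tb tab.
rewrite (le_trans (lip _ _ _ td ta tb tab))// ler_wpM2r//.
  exact: le_trans ta.
by rewrite mulrC -ler_pdivlMr// ltW.
Qed.
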